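(* Let $\epsilon\in\{0,\frac12\}$ and $b,b_1,b_2\in\mathbb{C}$. Then there exists a functor $H_{\epsilon,b}:\mathrm{Mod}\,\mathcal{D}\to\mathrm{Mod}\,\mathfrak{g}[\epsilon]$, $M\mapsto H_{\epsilon,b}(M)$, where $H_{\epsilon,b}(M)=M\oplus\overline{M}$ is equipped with the $\mathfrak{g}[\epsilon]$-action $$L_m\cdot v=-t^{m}\left(D+(m-2\epsilon)b+\frac{m+2\epsilon}{2}\theta\partial_\theta\right)v,$$ $$G_p\cdot v=t^{p-\epsilon}\left(\theta D+2(p-\epsilon)b\,\theta-t^{2\epsilon}\partial_\theta\right)v,$$ for $m\in\mathbb{Z}$, $p\in\mathbb{Z}+\epsilon$ and $v\in M\oplus\overline{M}$. Furthermore: (i) $H_{\epsilon,b}$ preserves irreducible modules (i.e. $H_{\epsilon,b}(M)$ is an irreducible $\mathfrak{g}[\epsilon]$-module for every irreducible $\mathcal{D}$-module $M$) if and only if $b\notin\{0,\frac12\}$. (ii) $H_{\epsilon,b_1}\cong H_{\epsilon,b_2}$ (natural isomorphism of functors) if and only if $b_1=b_2$.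
   Context: All vector spaces, algebras and modules are over $\mathbb{C}$; modules over Lie superalgebras are $\mathbb{Z}_2$-graded, and irreducible means nonzero with no nonzero proper ($\mathbb{Z}_2$-graded) submodule. $\mathrm{Mod}\,L$ denotes the category of $L$-modules. Super-Virasoro algebra (centerless): for $\epsilon\in\{0,\frac12\}$, $\mathfrak{g}[\epsilon]$ is the Lie superalgebra with even basis $\{L_n\mid n\in\mathbb{Z}\}$, odd basis $\{G_p\mid p\in\mathbb{Z}+\epsilon\}$, and brackets $[L_m,L_n]=(m-n)L_{m+n}$, $[G_p,G_q]=2L_{p+q}$, $[L_m,G_p]=(\frac m2-p)G_{m+p}$. Weyl algebra: $\mathcal{D}$ is the associative algebra generated by $t^{\pm1}$ and $\partial_t=\frac{d}{dt}$ subject to $\partial_t t-t\partial_t=1$; put $D=t\frac{d}{dt}$. For a $\mathcal{D}$-module $M$ let $\overline{M}=\{\overline v\mid v\in M\}$ be a copy of $M$. On $M\oplus\overline{M}$ (with $M$ even and $\overline{M}$ odd) let $x\in\mathcal{D}$ act on $M$ as given and on $\overline{M}$ by $x\cdot\overline v=\overline{xv}$, and let $\theta\cdot v=\overline v$, $\theta\cdot\overline v=0$, $\partial_\theta\cdot v=0$, $\partial_\theta\cdot\overline v=v$ for $v\in M$. On a morphism $f:M\to N$ of $\mathcal{D}$-modules the functor is given by $v\mapsto f(v)$, $\overline v\mapsto\overline{f(v)}$. *)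

(* Defs.v *)
(* MathComp world, with the classical axioms of mathcomp-classical. *)
From HB Require Import structures.
From mathcomp Require Import all_boot all_order all_algebra.
From mathcomp Require Import boolp reals.
From mathcomp Require Import complex.
From mathcomp.multinomials Require Import freeg.
From mathcomp Require Import ring.

Set Implicit Arguments.
Unset Strict Implicit.
Unset Printing Implicit Defensive.

Import GRing.Theory Num.Theory.
Local Open Scope ring_scope.

Record category := Category {
  obj :> Type;
  chom : obj -> obj -> Type;
  idc : forall A, chom A A;
  ccomp : forall A B C, chom B C -> chom A B -> chom A C;
  ccomp_idl : forall A B (f : chom A B), ccomp (idc B) f = f;
  ccomp_idr : forall A B (f : chom A B), ccomp f (idc A) = f;
  ccompA : forall A B C D (h : chom C D) (g : chom B C) (f : chom A B),
    ccomp h (ccomp g f) = ccomp (ccomp h g) f }.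

Record is_functor (C D : category) (F : C -> D)
    (Fm : forall A B : C, chom A B -> chom (F A) (F B)) : Prop := IsFunctor {
  functor_id : forall A : C, Fm A A (idc A) = idc (F A);
  functor_comp : forall (A B E : C) (g : chom B E) (f : chom A B),
    Fm A E (ccomp g f) = ccomp (Fm B E g) (Fm A B f) }.

Record functor (C D : category) := Functor {
  fobj :> C -> D;
  fmor : forall A B : C, chom A B -> chom (fobj A) (fobj B);
  functorP : is_functor fmor }.

Definition is_natural (C D : category) (F G : functor C D)
    (eta : forall A : C, chom (F A) (G A)) : Prop :=
  forall (A B : C) (f : chom A B),
    ccomp (eta B) (fmor F f) = ccomp (fmor G f) (eta A).

Definition is_iso (C : category) (A B : C) (f : chom A B) : Prop :=
  exists g : chom B A, ccomp g f = idc A /\ ccomp f g = idc B.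

Definition nat_isomorphic (C D : category) (F G : functor C D) : Prop :=
  exists eta : forall A : C, chom (F A) (G A),
    is_natural eta /\ forall A : C, is_iso (eta A).

Section Weyl.
Variable K : numFieldType.

Inductive wterm :=
  | WScal of K | WT | WTinv | WDt
  | WAdd of wterm & wterm | WMul of wterm & wterm.

HB.instance Definition _ := gen_eqMixin wterm.
HB.instance Definition _ := gen_choiceMixin wterm.

(* The least congruence making the terms an associative unital K-algebra,
   with K embedded by [WScal], in which the defining relations hold. *)
Inductive weq : wterm -> wterm -> Prop :=
  | weq_refl a : weq a a
  | weq_sym a b : weq a b -> weq b a
  | weq_trans a b c : weq a b -> weq b c -> weq a c
  | weq_add a a' b b' : weq a a' -> weq b b' -> weq (WAdd a b) (WAdd a' b')
  | weq_mul a a' b b' : weq a a' -> weq b b' -> weq (WMul a b) (WMul a' b')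
  | weq_addA a b c : weq (WAdd a (WAdd b c)) (WAdd (WAdd a b) c)
  | weq_addC a b : weq (WAdd a b) (WAdd b a)
  | weq_add0 a : weq (WAdd (WScal 0) a) a
  | weq_addN a : weq (WAdd (WMul (WScal (-1)) a) a) (WScal 0)
  | weq_mulA a b c : weq (WMul a (WMul b c)) (WMul (WMul a b) c)
  | weq_mul1 a : weq (WMul (WScal 1) a) a
  | weq_mulDl a b c : weq (WMul (WAdd a b) c) (WAdd (WMul a c) (WMul b c))
  | weq_mulDr a b c : weq (WMul a (WAdd b c)) (WAdd (WMul a b) (WMul a c))
  | weq_scalD k l : weq (WScal (k + l)) (WAdd (WScal k) (WScal l))
  | weq_scalM k l : weq (WScal (k * l)) (WMul (WScal k) (WScal l))
  | weq_scalC k a : weq (WMul (WScal k) a) (WMul a (WScal k))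
  | weq_TTinv : weq (WMul WT WTinv) (WScal 1)
  | weq_TinvT : weq (WMul WTinv WT) (WScal 1)
  | weq_DtT : weq (WMul WDt WT) (WAdd (WMul WT WDt) (WScal 1)).

Definition weqb (a b : wterm) : bool := `[< weq a b >].

Fact weqb_refl : reflexive weqb.
Proof. by move=> a; apply/asboolP/weq_refl. Qed.

Fact weqb_sym : symmetric weqb.
Proof.
by move=> a b; apply/idP/idP => /asboolP h; apply/asboolP/weq_sym.
Qed.

Fact weqb_trans : transitive weqb.
Proof.
by move=> b a c /asboolP h1 /asboolP h2; apply/asboolP/(weq_trans h1 h2).
Qed.

Canonical weqb_equiv := EquivRel weqb weqb_refl weqb_sym weqb_trans.

Definition weyl := {eq_quot weqb}%qT.
HB.instance Definition _ := Choice.on weyl.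

Definition wcl (a : wterm) : weyl := (\pi_({eq_quot weqb}) a)%qT.
Definition wrepr (x : weyl) : wterm := repr x.

Fact wclK x : wcl (wrepr x) = x. Proof. exact: reprK. Qed.

Fact wclP a b : wcl a = wcl b <-> weq a b.
Proof. by split=> [/eqmodP/asboolP|h] //; apply/eqmodP/asboolP. Qed.

Fact wreprK a : weq (wrepr (wcl a)) a.
Proof. by apply/wclP; rewrite wclK. Qed.

Definition waddq (x y : weyl) := wcl (WAdd (wrepr x) (wrepr y)).
Definition wmulq (x y : weyl) := wcl (WMul (wrepr x) (wrepr y)).
Definition wscalq (c : K) := wcl (WScal c).

Fact waddqE a b : waddq (wcl a) (wcl b) = wcl (WAdd a b).
Proof. by apply/wclP/weq_add; apply: wreprK. Qed.

Fact wmulqE a b : wmulq (wcl a) (wcl b) = wcl (WMul a b).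
Proof. by apply/wclP/weq_mul; apply: wreprK. Qed.

Fact weyl_ind (P : weyl -> Prop) : (forall a, P (wcl a)) -> forall x, P x.
Proof. by move=> h x; rewrite -(wclK x). Qed.

Ltac wsolve := repeat (elim/weyl_ind; intro);
  rewrite /wscalq ?(waddqE, wmulqE) //; apply/wclP.

Fact waddqA : associative waddq. Proof. by wsolve; apply: weq_addA. Qed.
Fact waddqC : commutative waddq. Proof. by wsolve; apply: weq_addC. Qed.
Fact wadd0q : left_id (wscalq 0) waddq.
Proof. by wsolve; apply: weq_add0. Qed.
Fact wmulqA : associative wmulq. Proof. by wsolve; apply: weq_mulA. Qed.
Fact wmul1q : left_id (wscalq 1) wmulq.
Proof. by wsolve; apply: weq_mul1. Qed.
Fact wscalqC c x : wmulq (wscalq c) x = wmulq x (wscalq c).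
Proof. by elim/weyl_ind: x => x; wsolve; apply: weq_scalC. Qed.
Fact wmulq1 : right_id (wscalq 1) wmulq.
Proof. by move=> x; rewrite -wscalqC wmul1q. Qed.
Fact wmulqDl : left_distributive wmulq waddq.
Proof. by wsolve; apply: weq_mulDl. Qed.
Fact wmulqDr : right_distributive wmulq waddq.
Proof. by wsolve; apply: weq_mulDr. Qed.
Fact wscalqD c d : wscalq (c + d) = waddq (wscalq c) (wscalq d).
Proof. by wsolve; apply: weq_scalD. Qed.
Fact wscalqM c d : wscalq (c * d) = wmulq (wscalq c) (wscalq d).
Proof. by wsolve; apply: weq_scalM. Qed.

Definition woppq (x : weyl) := wmulq (wscalq (-1)) x.

Fact waddNq : left_inverse (wscalq 0) woppq waddq.
Proof. by rewrite /woppq; wsolve; apply: weq_addN. Qed.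

HB.instance Definition _ :=
  GRing.isZmodule.Build weyl waddqA waddqC wadd0q waddNq.

(* A representation, on Laurent series [\sum_k f(k) t^k], showing [1 != 0]. *)
Fixpoint wser (a : wterm) (f : int -> K) : int -> K :=
  match a with
  | WScal c => fun k => c * f k
  | WT => fun k => f (k - 1)
  | WTinv => fun k => f (k + 1)
  | WDt => fun k => (k + 1)%:~R * f (k + 1)
  | WAdd a b => fun k => wser a f k + wser b f k
  | WMul a b => wser a (wser b f)
  end.

Fact wser_lin a c f g :
  wser a (fun k => c * f k + g k) = (fun k => c * wser a f k + wser a g k).
Proof.
elim: a c f g => [d||||a IHa b IHb|a IHa b IHb] c f g; apply/funext => k //=.
- by ring.
- by ring.
- by rewrite IHa IHb; ring.
- by rewrite IHb IHa.
Qed.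

Fact wser_weq a b : weq a b -> forall f, wser a f = wser b f.
Proof.
elim=> {a b}.
- by [].
- by move=> a b _ IH f; rewrite IH.
- by move=> a b c _ IH1 _ IH2 f; rewrite IH1 IH2.
- by move=> a a' b b' _ IH1 _ IH2 f /=; rewrite IH1 IH2.
- by move=> a a' b b' _ IH1 _ IH2 f /=; rewrite IH1 IH2.
- by move=> a b c f; apply/funext => k /=; ring.
- by move=> a b f; apply/funext => k /=; ring.
- by move=> a f; apply/funext => k /=; ring.
- by move=> a f; apply/funext => k /=; ring.
- by [].
- by move=> a f; apply/funext => k /=; ring.
- by [].
- move=> a b c f /=.
  have -> : (fun k => wser b f k + wser c f k)
          = (fun k => 1 * wser b f k + wser c f k).
    by apply/funext => k; rewrite mul1r.
  by rewrite wser_lin; apply/funext => k; rewrite mul1r.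
- by move=> k l f; apply/funext => n /=; ring.
- by move=> k l f; apply/funext => n /=; ring.
- move=> c a f /=.
  have -> : (fun k => c * f k) = (fun k => (c - 1) * f k + f k).
    by apply/funext => k; ring.
  by rewrite wser_lin; apply/funext => k; ring.
- by move=> f; apply/funext => k /=; rewrite mul1r subrK.
- by move=> f; apply/funext => k /=; rewrite mul1r addrK.
- by move=> f; apply/funext => k /=; rewrite addrK subrK intrD; ring.
Qed.

Fact wone_neq0 : wscalq 1 != 0 :> weyl.
Proof.
apply/eqP => /wclP/wser_weq/(_ (fun=> 1))/(congr1 (@^~ 0)) /=.
by rewrite mul1r mul0r => /eqP; rewrite oner_eq0.
Qed.

HB.instance Definition _ := GRing.Zmodule_isNzRing.Build weyl
  wmulqA wmul1q wmulq1 wmulqDl wmulqDr wone_neq0.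

Definition wscale (c : K) (x : weyl) : weyl := wscalq c * x.

Fact wscaleA c d x : wscale c (wscale d x) = wscale (c * d) x.
Proof. by rewrite /wscale mulrA; congr (_ * _); rewrite wscalqM. Qed.
Fact wscale1 : left_id 1 wscale.
Proof. exact: wmul1q. Qed.
Fact wscaleDr : right_distributive wscale +%R.
Proof. by move=> c x y; apply: mulrDr. Qed.
Fact wscaleDl x : {morph wscale^~ x : c d / c + d}.
Proof. by move=> c d; rewrite /wscale wscalqD mulrDl. Qed.

HB.instance Definition _ :=
  GRing.Zmodule_isLmodule.Build K weyl wscaleA wscale1 wscaleDr wscaleDl.

Fact wscaleAl c (x y : weyl) : c *: (x * y) = (c *: x) * y.
Proof. exact: mulrA. Qed.
HB.instance Definition _ := GRing.Lmodule_isLalgebra.Build K weyl wscaleAl.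

Fact wscaleAr c (x y : weyl) : c *: (x * y) = x * (c *: y).
Proof. by rewrite [LHS]mulrA [in RHS]mulrA; congr (_ * _); apply: wscalqC. Qed.
HB.instance Definition _ := GRing.Lalgebra_isAlgebra.Build K weyl wscaleAr.

Definition wt : weyl := wcl WT.
Definition wtinv : weyl := wcl WTinv.
Definition wdt : weyl := wcl WDt.

(* t^n; recall that [Negz k] is the integer -(k+1) *)
Definition wtpow (n : int) : weyl :=
  match n with Posz k => wt ^+ k | Negz k => wtinv ^+ k.+1 end.

(* the Euler operator D = t d/dt *)
Definition wD : weyl := wt * wdt.

Fact wt_wtinv : wt * wtinv = 1.
Proof. by rewrite [LHS]wmulqE; apply/wclP/weq_TTinv. Qed.
Fact wtinv_wt : wtinv * wt = 1.
Proof. by rewrite [LHS]wmulqE; apply/wclP/weq_TinvT. Qed.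
Fact wdt_wt : wdt * wt - wt * wdt = 1.
Proof.
apply/eqP; rewrite subr_eq addrC; apply/eqP.
rewrite [LHS]wmulqE [X in X + _]wmulqE [RHS]waddqE.
exact/wclP/weq_DtT.
Qed.

End Weyl.

Record superSpace (K : numFieldType) := SuperSpace {
  even_part : lmodType K;
  odd_part : lmodType K }.

Definition tot (K : numFieldType) (V : superSpace K) : lmodType K :=
  (even_part V * odd_part V)%type.

(* homogeneous of parity [i], with [false] for even and [true] for odd *)
Definition homog (K : numFieldType) (V : superSpace K) (i : bool)
    (v : tot V) : Prop := if i then v.1 = 0 else v.2 = 0.

Record lieSuperalgebra (K : numFieldType) := LieSuperalgebra {
  lie_space :> superSpace K;
  bracket : tot lie_space -> tot lie_space -> tot lie_space;
  bracket_linear_l : forall y, linear (bracket^~ y);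
  bracket_linear_r : forall x, linear (bracket x);
  bracket_homog : forall i j x y, homog i x -> homog j y ->
    homog (i (+) j) (bracket x y);
  bracket_skew : forall i j x y, homog i x -> homog j y ->
    bracket x y = - ((-1) ^+ (i && j) *: bracket y x);
  bracket_jacobi : forall i j x y z, homog i x -> homog j y ->
    bracket x (bracket y z) =
      bracket (bracket x y) z + (-1) ^+ (i && j) *: bracket y (bracket x z) }.

Record is_module (K : numFieldType) (g : lieSuperalgebra K) (V : superSpace K)
    (rho : tot g -> tot V -> tot V) : Prop := IsModule {
  rho_linear_l : forall v, linear (rho^~ v);
  rho_linear_r : forall x, linear (rho x);
  rho_homog : forall i j x v, homog i x -> homog j v ->
    homog (i (+) j) (rho x v);
  rho_bracket : forall i j x y v, homog i x -> homog j y ->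
    rho (bracket x y) v =
      rho x (rho y v) - (-1) ^+ (i && j) *: rho y (rho x v) }.

Record lieModule (K : numFieldType) (g : lieSuperalgebra K) := LieModule {
  mod_space :> superSpace K;
  mod_act : tot g -> tot mod_space -> tot mod_space;
  mod_actP : is_module mod_act }.

(* Morphisms of modules over a Lie superalgebra preserve the parity. *)
Record is_lie_morphism (K : numFieldType) (g : lieSuperalgebra K)
    (V W : lieModule g) (f : tot V -> tot W) : Prop := IsLieMorphism {
  lmor_linear : linear f;
  lmor_even : forall i v, homog i v -> homog i (f v);
  lmor_act : forall x v, f (mod_act x v) = mod_act x (f v) }.

Record lieMorphism (K : numFieldType) (g : lieSuperalgebra K)
    (V W : lieModule g) := LieMorphism {
  lmor_fun :> tot V -> tot W;
  lmorP : is_lie_morphism lmor_fun }.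

(* Submodules are Z_2-graded, i.e. stable under the projections to the even
   and odd parts. *)
Record lie_submodule (K : numFieldType) (g : lieSuperalgebra K)
    (V : lieModule g) (W : tot V -> Prop) : Prop := LieSubmodule {
  lsub_zero : W 0;
  lsub_linear : forall c v w, W v -> W w -> W (c *: v + w);
  lsub_graded : forall v, W v -> W (v.1, 0) /\ W (0, v.2);
  lsub_act : forall x v, W v -> W (mod_act x v) }.

Definition irreducible_lie_module (K : numFieldType) (g : lieSuperalgebra K)
    (V : lieModule g) : Prop :=
  (exists v : tot V, v <> 0) /\
  forall W : tot V -> Prop, lie_submodule W ->
    (forall v, W v -> v = 0) \/ (forall v, W v).

Fact linear_ext (A : pzRingType) (M N : lmodType A) (f g : {linear M -> N}) :
  f =1 g -> f = g.
Proof.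
case: f g => [f [[f1] [f2]]] [g [[g1] [g2]]] /= /funext fg.
move: f1 f2 g1 g2; rewrite fg => *.
by congr (GRing.Linear.Pack (GRing.Linear.Class _ _)); congr (_ _);
  apply: Prop_irrelevance.
Qed.

Definition Mod (A : pzRingType) : category.
Proof.
refine (@Category (lmodType A) (fun M N => {linear M -> N})
  (fun M => idfun) (fun M N P g f => g \o f) _ _ _);
  by move=> *; apply: linear_ext.
Defined.

Record is_submodule (A : pzRingType) (M : lmodType A) (W : M -> Prop) : Prop :=
  IsSubmodule {
    sub_zero : W 0;
    sub_linear : forall a v w, W v -> W w -> W (a *: v + w) }.

Definition irreducible_module (A : pzRingType) (M : lmodType A) : Prop :=
  (exists v : M, v <> 0) /\
  forall W : M -> Prop, is_submodule W ->
    (forall v, W v -> v = 0) \/ (forall v, W v).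

Section LieModuleCategory.
Variables (K : numFieldType) (g : lieSuperalgebra K).

Fact lieMorphism_ext (V W : lieModule g) (f h : lieMorphism V W) :
  f =1 h -> f = h.
Proof.
case: f h => [f fP] [h hP] /= /funext fh; move: fP hP; rewrite fh => fP hP.
by congr LieMorphism; apply: Prop_irrelevance.
Qed.

Fact lie_id_subproof (V : lieModule g) : is_lie_morphism (V := V) (W := V) idfun.
Proof. by []. Qed.

Definition lie_id (V : lieModule g) : lieMorphism V V :=
  LieMorphism (lie_id_subproof V).

Fact lie_comp_subproof (U V W : lieModule g) (h : lieMorphism V W)
  (f : lieMorphism U V) : is_lie_morphism (V := U) (W := W) (h \o f).
Proof.
case: h f => [h [h1 h2 h3]] [f [f1 f2 f3]]; split => /= [c u v|i v|x v].
- exact: etrans (congr1 h (f1 c u v)) (h1 c _ _).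
- by move/f2/h2.
- by rewrite f3 h3.
Qed.

Definition lie_comp (U V W : lieModule g) (h : lieMorphism V W)
  (f : lieMorphism U V) : lieMorphism U W := LieMorphism (lie_comp_subproof h f).

Definition LieMod : category.
Proof.
refine (@Category (lieModule g) (@lieMorphism K g) lie_id lie_comp _ _ _);
  by move=> *; apply: lieMorphism_ext.
Defined.

End LieModuleCategory.

Section SuperVirasoro.
Variables (K : numFieldType) (e : bool).

(* The boolean [e] is the number 2 epsilon in {0, 1}. *)
Definition eps : K := e%:R / 2.

(* The index set Z + epsilon is parametrized by Z: [eps_shift k] is k + epsilon. *)
Definition eps_shift (k : int) : K := k%:~R + eps.

Local Notation freeZ := {freeg int / K}.

Definition svir_space : superSpace K := SuperSpace freeZ freeZ.

(* L_m, and G_p for p = k + epsilon *)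
Definition svL (m : int) : tot svir_space := (<< m >>, 0).
Definition svG (k : int) : tot svir_space := (0, << k >>).

Definition bilin (M : lmodType K) (f : int -> int -> M) (x y : freeZ) : M :=
  fglift (fun m => fglift (f m) y) x.

(* [L_m, L_n] = (m - n) L_(m+n),  [G_p, G_q] = 2 L_(p+q) and
   [L_m, G_p] = (m/2 - p) G_(m+p), where p + q = k + l + 2 epsilon for
   p = k + epsilon and q = l + epsilon. *)
Definition svLL (m n : int) : freeZ := (m - n)%:~R *: << m + n >>.
Definition svGG (k l : int) : freeZ := 2 *: << k + l + e%:Z >>.
Definition svLG (m k : int) : freeZ := (m%:~R / 2 - eps_shift k) *: << m + k >>.

Definition svir_bracket (x y : tot svir_space) : tot svir_space :=
  (bilin svLL x.1 y.1 + bilin svGG x.2 y.2,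
   bilin svLG x.1 y.2 - bilin svLG y.1 x.2).

Fact fglift_linear (M : lmodType K) (f : int -> M) : linear (fglift f).
Proof.
have fgZ c x : fglift f (c *: x) = c *: fglift f x.
  elim/freeg_ind_dom0: x => [|k n x _ _ IH].
    by rewrite scaler0 fglift_Freeg prelift_nil scaler0.
  have addE u v : fglift f (u + v) = fglift f u + fglift f v.
    by have := lift_is_additive f u (- v); have := lift_is_additive f 0 v;
       rewrite sub0r fglift_Freeg prelift_nil sub0r opprK => -> ->; rewrite opprK.
  rewrite scalerDr !addE IH scalerDr; congr (_ + _).
  have -> : c *: << k *g n >> = << c * k *g n >> :> freeZ.
    by apply/eqP/freeg_eqP => m; rewrite coeffZ !coeffU mulrA.
  by rewrite !liftU scalerA.
move=> c x y; have := lift_is_additive f (c *: x) (- y).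
have := lift_is_additive f 0 y.
by rewrite sub0r fglift_Freeg prelift_nil sub0r opprK => -> ->; rewrite opprK fgZ.
Qed.

Fact fgliftD (M : lmodType K) (f : int -> M) x y :
  fglift f (x + y) = fglift f x + fglift f y.
Proof. by have := fglift_linear f 1 x y; rewrite !scale1r. Qed.

Fact fglift0 (M : lmodType K) (f : int -> M) : fglift f 0 = 0.
Proof. by rewrite fglift_Freeg prelift_nil. Qed.

Fact bilin_linear_l (M : lmodType K) (f : int -> int -> M) y :
  linear (bilin f ^~ y).
Proof. by move=> c x x'; apply: fglift_linear. Qed.

Fact bilin_linear_r (M : lmodType K) (f : int -> int -> M) x :
  linear (bilin f x).
Proof.
move=> c y y'; elim/freeg_ind_dom0: x => [|k n x _ _ IH].
  by rewrite /bilin !fglift0 scaler0 addr0.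
rewrite /bilin in IH *; rewrite !fgliftD IH !liftU fglift_linear.
by rewrite !scalerDr !scalerA [c * k]mulrC addrACA.
Qed.

Fact bilin0l (M : lmodType K) (f : int -> int -> M) y : bilin f 0 y = 0.
Proof. exact: fglift0. Qed.

Fact bilin0r (M : lmodType K) (f : int -> int -> M) x : bilin f x 0 = 0.
Proof.
by have := bilin_linear_r f x (-1) 0 0; rewrite scaler0 addr0 scaleN1r addNr.
Qed.

Fact bilinU (M : lmodType K) (f : int -> int -> M) m n :
  bilin f << m >> << n >> = f m n.
Proof. by rewrite /bilin !liftU !scale1r. Qed.

Fact svir_linear_l y : linear (svir_bracket^~ y).
Proof.
move=> c x x'; rewrite /svir_bracket /= !(bilin_linear_l, bilin_linear_r).
congr pair; rewrite /= scalerDr ?scalerN 1?addrACA //.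
by rewrite opprD addrACA.
Qed.

Fact svir_linear_r x : linear (svir_bracket x).
Proof.
move=> c y y'; rewrite /svir_bracket /= !(bilin_linear_l, bilin_linear_r).
congr pair; rewrite /= scalerDr ?scalerN 1?addrACA //.
by rewrite opprD addrACA.
Qed.

Fact svir_homog i j (x y : tot svir_space) : homog i x -> homog j y ->
  homog (i (+) j) (svir_bracket x y).
Proof.
case: x y i j => [x1 x2] [y1 y2] [] [] /= -> ->;
  by rewrite ?(bilin0l, bilin0r) ?subr0 ?addr0.
Qed.

Fact freeg_span (P : freeZ -> Prop) : P 0 ->
  (forall c x y, P x -> P y -> P (c *: x + y)) ->
  (forall n, P << n >>) -> forall x, P x.
Proof.
move=> P0 PD PU x; elim/freeg_ind_dom0: x => // k n x _ _ Px.
have -> : << k *g n >> = k *: << n >> :> freeZ.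
  by apply/eqP/freeg_eqP => m; rewrite coeffZ !coeffU mul1r.
exact: PD.
Qed.

Fact svir_span i (P : tot svir_space -> Prop) : P 0 ->
  (forall c x y, P x -> P y -> P (c *: x + y)) ->
  (forall n, P (if i then svG n else svL n)) ->
  forall x, homog i x -> P x.
Proof.
move=> P0 PD PU [x1 x2]; case: i PU => PU /= ->.
- elim/freeg_span: x2 => [//|c x y Px Py|n]; last exact: PU.
  by have := PD c _ _ Px Py; congr P; congr pair; rewrite /= scaler0 addr0.
- elim/freeg_span: x1 => [//|c x y Px Py|n]; last exact: PU.
  by have := PD c _ _ Px Py; congr P; congr pair; rewrite /= scaler0 addr0.
Qed.

Local Notation br := svir_bracket.

Fact brDl c x x' y : br (c *: x + x') y = c *: br x y + br x' y.
Proof. exact: svir_linear_l. Qed.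
Fact brDr c x y y' : br x (c *: y + y') = c *: br x y + br x y'.
Proof. exact: svir_linear_r. Qed.
Fact br0l y : br 0 y = 0.
Proof. by have := brDl (-1) 0 0 y; rewrite scaler0 addr0 scaleN1r addNr. Qed.
Fact br0r x : br x 0 = 0.
Proof. by have := brDr (-1) x 0 0; rewrite scaler0 addr0 scaleN1r addNr. Qed.
Fact brZl c x y : br (c *: x) y = c *: br x y.
Proof. by have := brDl c x 0 y; rewrite br0l !addr0. Qed.
Fact brZr c x y : br x (c *: y) = c *: br x y.
Proof. by have := brDr c x y 0; rewrite br0r !addr0. Qed.

Fact brLL m n : br (svL m) (svL n) = (m - n)%:~R *: svL (m + n).
Proof.
by rewrite /br /= bilinU !(bilin0l, bilin0r) addr0 subr0; congr pair;
   rewrite /= scaler0.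
Qed.
Fact brGG k l : br (svG k) (svG l) = 2 *: svL (k + l + e%:Z).
Proof.
by rewrite /br /= bilinU !(bilin0l, bilin0r) add0r subr0; congr pair;
   rewrite /= scaler0.
Qed.
Fact brLG m k : br (svL m) (svG k) = (m%:~R / 2 - eps_shift k) *: svG (m + k).
Proof.
by rewrite /br /= bilinU !(bilin0l, bilin0r) addr0 subr0; congr pair;
   rewrite /= scaler0.
Qed.
Fact brGL k m : br (svG k) (svL m) = - ((m%:~R / 2 - eps_shift k) *: svG (m + k)).
Proof.
by rewrite /br /= bilinU !(bilin0l, bilin0r) addr0 sub0r; congr pair;
   rewrite /= scaler0 oppr0.
Qed.

Fact svir_skew i j (x y : tot svir_space) : homog i x -> homog j y ->
  br x y = - ((-1) ^+ (i && j) *: br y x).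
Proof.
move=> hx hy; move: x hx; apply: svir_span.
- by rewrite br0l br0r scaler0 oppr0.
- move=> c x x' IH IH'; rewrite brDl brDr IH IH'.
  by rewrite scalerDr opprD scalerN !scalerA mulrC.
move=> m; move: y hy; apply: svir_span.
- by rewrite br0l br0r scaler0 oppr0.
- move=> c x x' IH IH'; rewrite brDl brDr IH IH'.
  by rewrite scalerDr opprD scalerN !scalerA mulrC.
move=> n; case: i j => [] [] /=; rewrite ?expr1 ?expr0 ?scale1r ?scaleN1r.
- by rewrite opprK !brGG [m + n]addrC.
- by rewrite brGL brLG.
- by rewrite brGL brLG opprK.
- by rewrite !brLL [m + n]addrC -scaleNr -mulrNz opprB.
Qed.

Fact svir_jacobi i j (x y z : tot svir_space) : homog i x -> homog j y ->
  br x (br y z) = br (br x y) z + (-1) ^+ (i && j) *: br y (br x z).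
Proof.
move=> hx hy; move: x hx; apply: svir_span.
- by rewrite !(br0l, br0r) scaler0 addr0.
- move=> c x x' IH IH'; rewrite !(brDl, brDr) IH IH'.
  by rewrite !scalerDr !scalerA mulrC addrACA.
move=> m; move: y hy; apply: svir_span.
- by rewrite !(br0l, br0r) scaler0 addr0.
- move=> c x x' IH IH'; rewrite !(brDl, brDr) IH IH'.
  by rewrite !scalerDr !scalerA mulrC addrACA.
move=> n.
suff hz l z' : homog l z' ->
    br (if i then svG m else svL m) (br (if j then svG n else svL n) z') =
    br (br (if i then svG m else svL m) (if j then svG n else svL n)) z' +
    (-1) ^+ (i && j) *:
    br (if j then svG n else svL n) (br (if i then svG m else svL m) z').
  have -> : z = 1 *: (z.1, 0) + (0, z.2) :> tot svir_space.
    rewrite scale1r; case: z => z1 z2; congr pair; rewrite /= ?addr0 ?add0r //.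
  by rewrite !(brDl, brDr) (hz false) // (hz true) // !scale1r scalerDr addrACA.
move: z'; apply: svir_span.
- by rewrite !(br0l, br0r) scaler0 addr0.
- move=> c y y' IH IH'; rewrite !(brDl, brDr) IH IH'.
  by rewrite !scalerDr !scalerA mulrC addrACA.
have collect (V : lmodType K) (I : zmodType) (f : I -> V) a b c p q r :
    a = b + c -> q = p -> r = p -> a *: f p = b *: f q + c *: f r.
  by move=> -> -> ->; rewrite scalerDl.
move=> k; case: i j l => [] [] [] /=;
  rewrite ?expr1 ?expr0 ?scale1r ?scaleN1r !(brLL, brGG, brLG, brGL);
  rewrite -?scaleNr !(brZl, brZr) ?(brLL, brGG, brLG, brGL) -?scaleNr;
  rewrite !scalerA -?scaleNr; apply: collect; rewrite /eps_shift /eps;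
  rewrite ?(rmorphD, rmorphN, rmorphB) /=; try ring; by case: (e) => /=; field.
Qed.

(* the Lie superalgebra g[epsilon] *)
Definition svir : lieSuperalgebra K :=
  LieSuperalgebra svir_linear_l svir_linear_r svir_homog svir_skew svir_jacobi.

End SuperVirasoro.

Section Doubling.
Variable K : numFieldType.

(* A copy of M carrying its structure of K-vector space, c acting as c *: 1
   in the Weyl algebra. *)
Definition underlying (M : lmodType (weyl K)) : Type := M.

Section Underlying.
Variable M : lmodType (weyl K).
HB.instance Definition _ := GRing.Zmodule.on (underlying M).

Definition underlying_scale (c : K) (v : underlying M) : underlying M :=
  (c%:A : weyl K) *: (v : M).

Fact underlying_scaleA c d v :
  underlying_scale c (underlying_scale d v) = underlying_scale (c * d) v.
Proof. by rewrite /underlying_scale scalerA -scalerAl mul1r scalerA. Qed.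
Fact underlying_scale1 : left_id 1 underlying_scale.
Proof. by move=> v; rewrite /underlying_scale !scale1r. Qed.
Fact underlying_scaleDr : right_distributive underlying_scale +%R.
Proof. by move=> c u v; apply: scalerDr. Qed.
Fact underlying_scaleDl v : {morph underlying_scale^~ v : c d / c + d}.
Proof. by move=> c d; rewrite /underlying_scale !scalerDl. Qed.

HB.instance Definition _ := GRing.Zmodule_isLmodule.Build K (underlying M)
  underlying_scaleA underlying_scale1 underlying_scaleDr underlying_scaleDl.

(* M (+) \bar M, with M even and \bar M odd; (v, w) stands for v + \bar w *)
Definition dbl : superSpace K := SuperSpace (underlying M) (underlying M).

Definition dact (x : weyl K) (v : tot dbl) : tot dbl :=
  ((x *: (v.1 : M) : M), (x *: (v.2 : M) : M)).

Definition theta (v : tot dbl) : tot dbl := (0, v.1).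
Definition dtheta (v : tot dbl) : tot dbl := (v.2, 0).
End Underlying.

Definition dbl_map (M N : lmodType (weyl K)) (f : {linear M -> N})
    (v : tot (dbl M)) : tot (dbl N) := (f v.1, f v.2).

End Doubling.

Definition preserves_irreducible (K : numFieldType) (A : pzRingType)
    (g : lieSuperalgebra K) (F : functor (Mod A) (LieMod g)) : Prop :=
  forall M : lmodType A, irreducible_module M -> irreducible_lie_module (F M).

(* Main.v *)
From HB Require Import structures.
Require Import Defs.
From mathcomp Require Import all_boot all_order all_algebra.
From mathcomp Require Import boolp reals complex.
From mathcomp.multinomials Require Import freeg.
From mathcomp Require Import ring.
Set Implicit Arguments.
Unset Strict Implicit.
Unset Printing Implicit Defensive.
Import GRing.Theory Num.Theory.
Local Open Scope ring_scope.

(** Write [e = 2 epsilon] and identify an element of the doubled module with a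
    pair [(v, w)], standing for [v + \bar w]. Up to sign, all operators then
    have entries of the form [t^n (D + c)] or [t^n]:

    - [L_m] acts on the even part by [- t^m (D + (m - e) b)] and on the odd part
      by [- t^m (D + (m - e) b + (m + e)/2)];
    - [G_(k + epsilon)] maps the odd part to the even one by [- t^(k + e)] and
      the even part to the odd one by [t^k (D + 2 k b)].

    Since [D t^n = t^n (D + n)], the bracket relations become identities between
    polynomials of degree two in [D], with scalar coefficients
    ([wtD_commutator], [svir_act_bracket]).

    For irreducibility, a graded submodule is a pair [(We, Wo)]. Composing two
    odd operators in both orders, [We] is stable under all [t^(n + k) (D + 2 k b)]
    and [Wo] under all [t^(n + k) (D + n + 2 k b)]. Keeping [n + k] fixed and
    varying [k], differences give [2 b t^n] on [We] and [(1 - 2 b) t^n] on [Wo];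
    so when [b] is neither 0 nor 1/2 both are stable under the Weyl algebra,
    hence zero or everything, and the odd operators force them to be zero or
    everything together ([irreducible_dbl]). Conversely, on the irreducible
    module of Laurent polynomials, [ker D] on the even side is a proper submodule when [b = 0], and
    the even part together with [im D] on the odd side is one when [b = 1/2]:
    the constant 1 lies in [ker D] but not in [im D] ([laurent_reducible]).

    An isomorphism between the modules attached to [b1] and [b2] is a pair of
    bijections intertwining the odd operators. From odd to even it commutes
    with all [t^n], so that both components are the same map; from even to odd,
    comparing [D] with [t (D + 2 b1)] and [t (D + 2 b2)] gives
    [2 (b1 - b2) t = 0] on its image, whence [b1 = b2] ([iso_eq]). *)

(** * Commutation rules in the Weyl algebra *)

Section WeylIdentities.
Variable K : numFieldType.
Implicit Types (n m : int) (a b c d s f : K).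

Local Notation A := (weyl K).
Local Notation D := (wD K).

Lemma wtpowS n : wtpow K (n + 1) = wt K * wtpow K n.
Proof.
case: n => [n|[|n]].
- by rewrite addrC -intS /= exprS.
- by rewrite /= expr0 expr1 wt_wtinv.
- rewrite NegzE intS opprD addrC addNKr -NegzE /= [in RHS]exprS mulrA.
  by rewrite wt_wtinv mul1r.
Qed.

Lemma wtpowP n : wtpow K (n - 1) = wtinv K * wtpow K n.
Proof. by rewrite -{2}(subrK 1 n) wtpowS mulrA wtinv_wt mul1r. Qed.

Lemma wtpowD n m : wtpow K (n + m) = wtpow K n * wtpow K m.
Proof.
elim/int_ind: n => [|n IH|n IH]; first by rewrite add0r mul1r.
- by rewrite intS [1 + _]addrC addrAC !wtpowS IH mulrA.
- by rewrite intS [1 + _]addrC opprD addrAC !wtpowP IH mulrA.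
Qed.

Lemma wtpowNK n : wtpow K (- n) * wtpow K n = 1.
Proof. by rewrite -wtpowD addNr. Qed.

Lemma wD_wt : D * wt K = wt K * (D + 1).
Proof.
have /eqP := wdt_wt K; rewrite subr_eq => /eqP h.
by rewrite /wD -mulrA h addrC.
Qed.

Lemma wD_wtpow n : D * wtpow K n = wtpow K n * (D + (n%:~R : K)%:A).
Proof.
elim/int_ind: n => [|n IH|n IH]; first by rewrite scale0r addr0 mulr1 mul1r.
- rewrite intS [1 + _]addrC wtpowS mulrA wD_wt -!mulrA; congr (_ * _).
  rewrite mulrDl IH mul1r rmorphD scalerDl scale1r addrA [in RHS]mulrDr.
  by rewrite mulr1.
- have wDti : D * wtinv K = wtinv K * (D - 1).
    have h : wtinv K * D = (D + 1) * wtinv K.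
      rewrite -[LHS]mulr1 -{1}(wt_wtinv K) mulrA -[_ * D * _]mulrA wD_wt.
      by rewrite [wtinv K * _]mulrA wtinv_wt mul1r.
    by rewrite mulrBr mulr1 h mulrDl mul1r addrK.
  rewrite intS [1 + _]addrC opprD wtpowP mulrA wDti -!mulrA; congr (_ * _).
  rewrite mulrBl IH mul1r rmorphB scalerBl scale1r addrA [in RHS]mulrBr.
  by rewrite mulr1.
Qed.

Lemma wdt_wtpow : wdt K = wtpow K (- 1) * D.
Proof. by rewrite /wD mulrA /= expr1 wtinv_wt mul1r. Qed.

(** The operator [t^n (D + c)]. *)
Definition wtD n c : A := wtpow K n * (D + c%:A).

Lemma alg_comm c (x : A) : x * c%:A = c *: x.
Proof. by rewrite -scalerAr mulr1. Qed.

Lemma wtD_wtpow n c m : wtD n c * wtpow K m = wtD (n + m) (c + m%:~R).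
Proof.
rewrite /wtD wtpowD -!mulrA; congr (_ * _).
rewrite mulrDl wD_wtpow -scalerAl mul1r -[c *: _]alg_comm.
rewrite -mulrDr -addrA -scalerDl.
by rewrite [_ + c]addrC.
Qed.

Lemma wtpow_wtD m n c : wtpow K m * wtD n c = wtD (m + n) c.
Proof. by rewrite /wtD mulrA wtpowD. Qed.

Lemma wtDB n c d : wtD n c - wtD n d = (c - d) *: wtpow K n.
Proof. by rewrite /wtD -mulrBr opprD addrACA subrr add0r -scalerBl alg_comm. Qed.

Lemma wtDD n c d : wtD n c + wtD n d = 2 *: wtD n ((c + d) / 2).
Proof.
rewrite /wtD -mulrDr scalerAr; congr (_ * _).
rewrite addrACA -scalerDl scalerDr scalerA mulrCA divff ?pnatr_eq0 // mulr1.
by rewrite scaler_nat mulr2n.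
Qed.

Lemma D_quadratic a b :
  (D + a%:A) * (D + b%:A) = D * D + (a + b) *: D + (a * b)%:A.
Proof.
rewrite mulrDl !mulrDr !alg_comm -!scalerAl !mul1r scalerA.
by rewrite [a + b]addrC [a * b]mulrC scalerDl !addrA.
Qed.

(** A difference of two products of operators [t^n (D + c)] with the same
    total degree in [t] is a multiple of an operator of that form, as soon as
    the coefficients of [D] and of 1 agree; the terms in [D^2] always cancel. *)
Lemma wtD_commutator n m k l a b c d s f :
    k + l = n + m -> a + m%:~R + b = c + l%:~R + d + s ->
    (a + m%:~R) * b = (c + l%:~R) * d + s * f ->
  wtD n a * wtD m b - wtD k c * wtD l d = s *: wtD (n + m) f.
Proof.
move=> klN e1 e2.
rewrite {2}/wtD mulrA wtD_wtpow [wtD l d]/wtD [X in _ - X]mulrA wtD_wtpow klN.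
rewrite /wtD -!mulrA -mulrBr scalerAr !D_quadratic; congr (_ * _).
have cancel (V : zmodType) (x y z u v : V) :
    x + y + z - (x + u + v) = (y - u) + (z - v).
  rewrite !opprD !addrA [x + y]addrC [y + x + z]addrAC addrK.
  by rewrite [y + z - u]addrAC.
rewrite cancel -!scalerBl e1 e2.
by rewrite [_ + s]addrC [_ + s * f]addrC !addrK scalerDr scalerA.
Qed.

End WeylIdentities.

(** Scalars, powers of [t] and [D] generate the Weyl algebra. *)
Lemma weyl_submodule (K : numFieldType) (M : lmodType (weyl K))
    (P : M -> Prop) :
    P 0 -> (forall u v, P u -> P v -> P (u + v)) ->
    (forall c v, P v -> P (c%:A *: v)) ->
    (forall n v, P v -> P (wtpow K n *: v)) ->
    (forall v, P v -> P (wD K *: v)) -> is_submodule P.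
Proof.
move=> P0 PD PZ Pt Pd; split=> // x u v Pu Pv; apply: (PD) => // {v Pv}.
elim/weyl_ind: x => a; elim: a u Pu => [c||||a IHa c IHc|a IHa c IHc] u Pu.
- have -> : wcl (WScal c) = c%:A :> weyl K by rewrite -[LHS]mulr1.
  exact: (PZ).
- exact: (Pt 1).
- exact: (Pt (- 1)).
- by rewrite -/(wdt K) wdt_wtpow -scalerA; apply/Pt/Pd.
- have -> : wcl (WAdd a c) = wcl a + wcl c :> weyl K by rewrite [RHS]waddqE.
  by rewrite scalerDl; apply: (PD); [apply: IHa | apply: IHc].
- have -> : wcl (WMul a c) = wcl a * wcl c :> weyl K by rewrite [RHS]wmulqE.
  by rewrite -scalerA; apply/IHa/IHc.
Qed.

(** * The action of the super-Virasoro algebra *)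

Section UnderlyingAction.
Variables (K : numFieldType) (M : lmodType (weyl K)).
Implicit Types (x y : weyl K) (v w : underlying M) (c : K).

(** The action of the Weyl algebra on the vector space underlying [M]. *)
Definition uact x v : underlying M := x *: (v : M).

Lemma uactDl x y v : uact (x + y) v = uact x v + uact y v.
Proof. exact: (@scalerDl _ M). Qed.

Lemma uactBl x y v : uact (x - y) v = uact x v - uact y v.
Proof. exact: (@scalerBl _ M). Qed.

Lemma uactDr x v w : uact x (v + w) = uact x v + uact x w.
Proof. exact: (@scalerDr _ M). Qed.

Lemma uactNr x v : uact x (- v) = - uact x v.
Proof. exact: (@scalerN _ M). Qed.

Lemma uact0 x : uact x 0 = 0.
Proof. exact: (@scaler0 _ M). Qed.

Lemma uact1 v : uact 1 v = v.
Proof. exact: (@scale1r _ M). Qed.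

Lemma uactM x y v : uact (x * y) v = uact x (uact y v).
Proof. by rewrite /uact scalerA. Qed.

Lemma uact_alg c v : uact c%:A v = c *: v.
Proof. by []. Qed.

Lemma uactZl c x v : uact (c *: x) v = c *: uact x v.
Proof. by rewrite -[x in LHS]mul1r scalerAl uactM. Qed.

Lemma uactZr c x v : uact x (c *: v) = c *: uact x v.
Proof. by rewrite -uactZl -(alg_comm c x) uactM. Qed.

Lemma dactE x (v : tot (dbl M)) : dact x v = (uact x v.1, uact x v.2).
Proof. by []. Qed.

End UnderlyingAction.

Lemma tot_eq (K : numFieldType) (W : superSpace K) (u v : tot W) :
  u.1 = v.1 -> u.2 = v.2 -> u = v.
Proof. by case: u v => [? ?] [? ?] /= -> ->. Qed.

Section Action.
Variables (K : numFieldType) (e : bool) (b : K) (M : lmodType (weyl K)).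

Local Notation g := (svir K e).
Local Notation eps := (eps K e).
Local Notation V := (tot (dbl M)).
Implicit Types (v w : V) (m n k l : int).

(** The operator by which [L_m] acts. *)
Definition svir_actL m v : V :=
  - dact (wtpow K m)
      (dact (wD K) v + ((m%:~R - 2 * eps) * b) *: v
       + ((m%:~R + 2 * eps) / 2) *: theta (dtheta v)).

(** The operator by which [G_p] acts, with [p = k + epsilon]. *)
Definition svir_actG k v : V :=
  let p : K := k%:~R + eps in
  dact (wtpow K k)
    (theta (dact (wD K) v) + (2 * (p - eps) * b) *: theta v
     - dact (wtpow K e%:Z) (dtheta v)).

(** The bilinear extension of [svir_actL] and [svir_actG]. *)
Definition svir_act (x : tot g) (v : V) : V :=
  fglift (svir_actL^~ v) x.1 + fglift (svir_actG^~ v) x.2.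

(** The constants [c] for which [L_m] acts by [- t^m (D + c)] on the even and on
    the odd part. *)
Definition weight_even m : K := (m%:~R - e%:R) * b.
Definition weight_odd m : K := (m%:~R - e%:R) * b + (m%:~R + e%:R) / 2.

Lemma twoeps : 2 * eps = e%:R.
Proof. by rewrite /Defs.eps mulrCA divff ?mulr1 ?pnatr_eq0. Qed.

Lemma svir_actLE m v :
  svir_actL m v
    = (- uact (wtD m (weight_even m)) v.1, - uact (wtD m (weight_odd m)) v.2).
Proof.
rewrite /svir_actL twoeps !dactE; apply: tot_eq => /=.
- by rewrite scaler0 addr0 -uact_alg -uactDl -uactM.
- by rewrite -!uact_alg -!uactDl -uactM -addrA -scalerDl.
Qed.

Lemma svir_actGE k v :
  svir_actG k v
    = (- uact (wtpow K (k + e)) v.2, uact (wtD k (2 * k%:~R * b)) v.1).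
Proof.
rewrite /svir_actG addrK !dactE; apply: tot_eq => /=.
- by rewrite scaler0 !add0r uactNr wtpowD uactM.
- by rewrite uact0 subr0 -uact_alg -uactDl -uactM.
Qed.

End Action.

Section ActionIsModule.
Variables (K : numFieldType) (e : bool) (b : K) (M : lmodType (weyl K)).

Local Notation g := (svir K e).
Local Notation V := (tot (dbl M)).
Local Notation act := (@svir_act K e b M).
Local Notation actL := (@svir_actL K e b M).
Local Notation actG := (@svir_actG K e b M).
Implicit Types (v w : V) (m n k l : int).

Lemma svir_act_linear_l v : linear (act^~ v).
Proof.
move=> c x y; rewrite /svir_act /= !fglift_linear.
by rewrite scalerDr addrACA.
Qed.

Lemma svir_act_svL m v : act (svL K m) v = actL m v.
Proof. by rewrite /svir_act /= liftU scale1r fglift0 addr0. Qed.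

Lemma svir_act_svG k v : act (svG K k) v = actG k v.
Proof. by rewrite /svir_act /= liftU scale1r fglift0 add0r. Qed.

Lemma svir_actL_linear m : linear (actL m).
Proof.
move=> c v w; rewrite !svir_actLE; apply: tot_eq; rewrite /= !uactDr !uactZr.
- by rewrite opprD scalerN.
- by rewrite opprD scalerN.
Qed.

Lemma svir_actG_linear k : linear (actG k).
Proof.
move=> c v w; rewrite !svir_actGE; apply: tot_eq; rewrite /= !uactDr !uactZr //.
by rewrite opprD scalerN.
Qed.

Lemma svir_act_linear_r x : linear (act x).
Proof.
move=> c v w; rewrite /svir_act.
have lin (f : int -> V -> V) : (forall m, linear (f m)) -> forall y,
    fglift (f^~ (c *: v + w)) y = c *: fglift (f^~ v) y + fglift (f^~ w) y.
  move=> flin; apply: freeg_span => [|d y z IHy IHz|m].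
  - by rewrite !fglift0 scaler0 addr0.
  - by rewrite !fglift_linear IHy IHz !scalerDr !scalerA [d * c]mulrC addrACA.
  - by rewrite !liftU !scale1r flin.
rewrite (lin _ svir_actL_linear) (lin _ svir_actG_linear).
by rewrite scalerDr addrACA.
Qed.

Lemma actDl c x y v : act (c *: x + y) v = c *: act x v + act y v.
Proof. exact: svir_act_linear_l. Qed.
Lemma actDr c x v w : act x (c *: v + w) = c *: act x v + act x w.
Proof. exact: svir_act_linear_r. Qed.
Lemma act0l v : act 0 v = 0.
Proof. by have := actDl (-1) 0 0 v; rewrite scaler0 addr0 scaleN1r addNr. Qed.
Lemma act0r x : act x 0 = 0.
Proof. by have := actDr (-1) x 0 0; rewrite scaler0 addr0 scaleN1r addNr. Qed.
Lemma actZl c x v : act (c *: x) v = c *: act x v.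
Proof. by have := actDl c x 0 v; rewrite act0l !addr0. Qed.

Lemma svir_act_homog i j (x : tot g) v : homog i x -> homog j v ->
  homog (i (+) j) (act x v).
Proof.
move=> hx hv; move: x hx; apply: svir_span => [|c x y hx hy|m].
- by rewrite act0l; case: (_ (+) _).
- rewrite actDl; move: hx hy; rewrite /homog.
  by case: (_ (+) _) => /= -> ->; rewrite scaler0 addr0.
- have -> : act (if i then svG K m else svL K m) v
           = if i then actG m v else actL m v.
    by case: (i); rewrite ?svir_act_svG ?svir_act_svL.
  case: i j hv => [] [] hv; rewrite /homog ?svir_actGE ?svir_actLE /=;
    by move: hv => /= ->; rewrite uact0 ?oppr0.
Qed.

Lemma svir_actLL m n v :
  actL m (actL n v) - actL n (actL m v) = (m - n)%:~R *: actL (m + n) v.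
Proof.
rewrite !svir_actLE; apply: tot_eq => /=; rewrite !uactNr !opprK -!uactM -uactBl;
  rewrite scalerN -scaleNr -uactZl; congr uact;
  apply: wtD_commutator; rewrite ?[n + m]addrC //;
  rewrite /weight_odd /weight_even ?rmorphD ?rmorphB /=; by field.
Qed.

Lemma svir_actLG m k v :
  actL m (actG k v) - actG k (actL m v)
    = (m%:~R / 2 - eps_shift K e k) *: actG (m + k) v.
Proof.
rewrite !svir_actLE !svir_actGE; apply: tot_eq => /=.
- rewrite !uactNr !opprK scalerN -uactM -uactM -uactBl -scaleNr -uactZl.
  congr uact; rewrite wtD_wtpow wtpow_wtD.
  rewrite [X in _ - wtD X _]addrC wtDB addrA.
  congr (_ *: _).
  rewrite /weight_odd /weight_even /eps_shift /eps rmorphD /=.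
  by field.
- rewrite uactNr opprK addrC -uactM -uactM -uactBl -uactZl; congr uact.
  rewrite [m + k]addrC; apply: wtD_commutator; rewrite ?[m + k]addrC //;
  rewrite /weight_odd /weight_even /eps_shift /eps ?rmorphD /=; by field.
Qed.

Lemma svir_actGG k l v :
  actG k (actG l v) + actG l (actG k v) = 2 *: actL (k + l + e) v.
Proof.
rewrite !svir_actGE !svir_actLE; apply: tot_eq => /=.
- rewrite -!uactM -opprD -uactDl scalerN -uactZl; congr (- uact _ _).
  rewrite !wtpow_wtD [k + e + l]addrAC [l + e + k]addrAC [l + k]addrC.
  rewrite wtDD; congr (_ *: wtD _ _).
  by rewrite /weight_even !rmorphD /=; field.
- rewrite !uactNr -opprD -!uactM -uactDl scalerN -uactZl; congr (- uact _ _).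
  rewrite !wtD_wtpow [l + (k + e)]addrCA addrA wtDD; congr (_ *: wtD _ _).
  by rewrite /weight_odd !rmorphD /=; field.
Qed.

Lemma svir_act_bracket i j (x y : tot g) v : homog i x -> homog j y ->
  act (svir_bracket e x y) v
    = act x (act y v) - (-1) ^+ (i && j) *: act y (act x v).
Proof.
move=> hx hy; move: x hx; apply: svir_span.
- by rewrite br0l !act0l act0r scaler0 subr0.
- move=> c x x' IH IH'; rewrite brDl !actDl actDr IH IH'.
  rewrite scalerBr [(-1) ^+ _ *: (c *: _ + _)]scalerDr.
  by rewrite opprD !scalerA [c * _]mulrC addrACA.
move=> m; move: y hy; apply: svir_span.
- by rewrite br0r !act0l act0r scaler0 subr0.
- move=> c y y' IH IH'; rewrite brDr !actDl actDr IH IH'.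
  rewrite scalerBr [(-1) ^+ _ *: (c *: _ + _)]scalerDr.
  by rewrite opprD !scalerA [c * _]mulrC addrACA.
move=> n; case: i j => [] [] /=; rewrite ?expr1 ?expr0 ?scale1r ?scaleN1r.
- by rewrite brGG actZl !svir_act_svG svir_act_svL opprK svir_actGG.
- rewrite brGL -scaleNr actZl !svir_act_svG !svir_act_svL scaleNr.
  by rewrite -svir_actLG opprB.
- by rewrite brLG actZl !svir_act_svG !svir_act_svL svir_actLG.
- by rewrite brLL actZl !svir_act_svL svir_actLL.
Qed.

Lemma svir_act_is_module : is_module (g := g) act.
Proof.
split.
- exact: svir_act_linear_l.
- exact: svir_act_linear_r.
- exact: svir_act_homog.
- exact: svir_act_bracket.
Qed.

End ActionIsModule.

(** * Modules over the Weyl algebra from operators *)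

(** Three operators on a vector space satisfying the relations between [t],
    its inverse and [d/dt]. *)
Record weylRep (K : numFieldType) (V : lmodType K) := WeylRep {
  repT : {linear V -> V};
  repTinv : {linear V -> V};
  repDt : {linear V -> V};
  repTTinv : forall v, repT (repTinv v) = v;
  repTinvT : forall v, repTinv (repT v) = v;
  repDtT : forall v, repDt (repT v) = repT (repDt v) + v }.

(** A copy of [V] carrying the structure of module over the Weyl algebra defined
    by [r]. *)
Definition weyl_module (K : numFieldType) (V : lmodType K) (r : weylRep V) :
  Type := V.

Section WeylModule.
Variables (K : numFieldType) (V : lmodType K) (r : weylRep V).

(** The operator on [V] denoted by a term. *)
Fixpoint weval (a : wterm K) : V -> V :=
  match a with
  | WScal c => fun v => c *: v
  | WT => repT r
  | WTinv => repTinv r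
  | WDt => repDt r
  | WAdd a b => fun v => weval a v + weval b v
  | WMul a b => fun v => weval a (weval b v)
  end.

Lemma weval_linear a : linear (weval a).
Proof.
elim: a => [d||||a IHa b IHb|a IHa b IHb] c u v /=; try exact: linearP.
- by rewrite IHa IHb scalerDr addrACA.
- by rewrite IHb IHa.
Qed.

Lemma weval_weq a b : weq a b -> weval a =1 weval b.
Proof.
have lin a' := weval_linear a'.
elim=> {a b} //=.
- by move=> a b _ IH v; rewrite IH.
- by move=> a b c _ IH1 _ IH2 v; rewrite IH1 IH2.
- by move=> a a' b b' _ IH1 _ IH2 v; rewrite IH1 IH2.
- by move=> a a' b b' _ IH1 _ IH2 v; rewrite IH1 IH2.
- by move=> a b c v; rewrite addrA.
- by move=> a b v; rewrite addrC.
- by move=> a v; rewrite scale0r add0r.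
- by move=> a v; rewrite scale0r scaleN1r addNr.
- by move=> a v; rewrite scale1r.
- by move=> a b c v; have := lin a 1 (weval b v) (weval c v); rewrite !scale1r.
- by move=> k l v; rewrite scalerDl.
- by move=> k l v; rewrite scalerA.
- move=> k a v; have := lin a k v 0; rewrite !addr0 => ->.
  have := lin a (-1) 0 0; rewrite scaler0 addr0 scaleN1r addNr => ->.
  by rewrite addr0.
- by move=> v; rewrite repTTinv scale1r.
- by move=> v; rewrite repTinvT scale1r.
- by move=> v; rewrite repDtT scale1r.
Qed.

Local Notation weyl_module := (weyl_module r).
HB.instance Definition _ := GRing.Zmodule.on weyl_module.

Definition weyl_scale (x : weyl K) (v : weyl_module) : weyl_module :=
  weval (wrepr x) v.

Lemma weyl_scaleE a v : weyl_scale (wcl a) v = weval a v.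
Proof. exact/weval_weq/wreprK. Qed.

Fact weyl_scaleA x y v : weyl_scale x (weyl_scale y v) = weyl_scale (x * y) v.
Proof.
elim/weyl_ind: x => a; elim/weyl_ind: y => c.
by rewrite [wcl a * wcl c]wmulqE !weyl_scaleE.
Qed.

Fact weyl_scale1 : left_id 1 weyl_scale.
Proof. by move=> v; rewrite weyl_scaleE /= scale1r. Qed.

Fact weyl_scaleDr : right_distributive weyl_scale +%R.
Proof.
move=> x u v; have := weval_linear (wrepr x) 1 u v.
by rewrite !scale1r.
Qed.

Fact weyl_scaleDl v : {morph weyl_scale^~ v : x y / x + y}.
Proof.
move=> x y; elim/weyl_ind: x => a; elim/weyl_ind: y => c.
by rewrite [wcl a + wcl c]waddqE !weyl_scaleE.
Qed.

HB.instance Definition _ := GRing.Zmodule_isLmodule.Build (weyl K) weyl_module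
  weyl_scaleA weyl_scale1 weyl_scaleDr weyl_scaleDl.

Implicit Type v : weyl_module.

Lemma wt_scale v : wt K *: v = repT r v.
Proof. exact: weyl_scaleE. Qed.

Lemma wtinv_scale v : wtinv K *: v = repTinv r v.
Proof. exact: weyl_scaleE. Qed.

Lemma wD_scale v : wD K *: v = repT r (repDt r v).
Proof. by rewrite -scalerA wt_scale; congr (repT r _); apply: weyl_scaleE. Qed.

Lemma alg_scale (c : K) v : (c%:A : weyl K) *: v = (c *: (v : V) : V).
Proof.
have -> : (c%:A : weyl K) = wcl (WScal c) by apply: mulr1.
exact: weyl_scaleE.
Qed.

End WeylModule.

(** * The module of Laurent polynomials *)

Section Laurent.
Variable K : numFieldType.

Local Notation freeZ := {freeg int / K}.

Section Extension.
Variables (V : lmodType K) (f : int -> V).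
(** The linear extension of a function on monomials. *)
Definition lext : freeZ -> V := fglift f.
HB.instance Definition _ :=
  GRing.isLinear.Build K freeZ V *:%R lext (fglift_linear f).
Lemma lextU n : lext << n >> = f n.
Proof. by rewrite /lext liftU scale1r. Qed.
End Extension.

Lemma freeg_linear_eq (V : lmodType K) (f h : {linear freeZ -> V}) :
  (forall n, f << n >> = h << n >>) -> f =1 h.
Proof.
move=> fh; apply: freeg_span => [|c x y IHx IHy|//]; first by rewrite !linear0.
by rewrite !linearP IHx IHy.
Qed.

(** Multiplication by [t], by its inverse, and [d/dt]; [<< n >>] is [t^n]. *)
Definition laurent_T : {linear freeZ -> freeZ} := lext (fun n => << n + 1 >>).
Definition laurent_Tinv : {linear freeZ -> freeZ} :=
  lext (fun n => << n - 1 >>).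
Definition laurent_Dt : {linear freeZ -> freeZ} :=
  lext (fun n => n%:~R *: << n - 1 >>).

Lemma laurent_TTinv v : laurent_T (laurent_Tinv v) = v.
Proof.
move: v.
apply: (freeg_linear_eq (f := laurent_T \o laurent_Tinv) (h := idfun)) => n /=.
by rewrite /laurent_T /laurent_Tinv !lextU subrK.
Qed.

Lemma laurent_TinvT v : laurent_Tinv (laurent_T v) = v.
Proof.
move: v.
apply: (freeg_linear_eq (f := laurent_Tinv \o laurent_T) (h := idfun)) => n /=.
by rewrite /laurent_T /laurent_Tinv !lextU addrK.
Qed.

Lemma laurent_DtT v : laurent_Dt (laurent_T v) = laurent_T (laurent_Dt v) + v.
Proof.
move: v; apply: (freeg_linear_eq (f := laurent_Dt \o laurent_T)
  (h := (laurent_T \o laurent_Dt) \+ idfun)) => n /=.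
rewrite /laurent_Dt /laurent_T !lextU linearZ /= lextU addrK subrK.
by rewrite rmorphD scalerDl scale1r.
Qed.

(** The module of Laurent polynomials over the Weyl algebra. *)
Definition laurent : lmodType (weyl K) :=
  weyl_module (WeylRep laurent_TTinv laurent_TinvT laurent_DtT).

Local Notation mono n := (<< n >> : laurent).

Lemma laurent_wD n : wD K *: mono n = (n%:~R : K)%:A *: mono n.
Proof.
rewrite wD_scale alg_scale /= /laurent_Dt /laurent_T lextU linearZ /= lextU.
by rewrite subrK.
Qed.

Lemma laurent_wtpow m n : wtpow K m *: mono n = mono (m + n).
Proof.
elim/int_ind: m => [|m IH|m IH]; first by rewrite scale1r add0r.
- rewrite intS [1 + _]addrC wtpowS -scalerA IH wt_scale /= /laurent_T lextU.
  by rewrite addrAC.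
- rewrite intS [1 + _]addrC opprD wtpowP -scalerA IH wtinv_scale /=.
  by rewrite /laurent_Tinv lextU addrAC.
Qed.

Lemma coeff_wD m (x : laurent) :
  coeff m (wD K *: x : freeZ) = m%:~R * coeff m (x : freeZ).
Proof.
elim/freeg_span: x => [|c x y IHx IHy|n].
- by rewrite scaler0 coeff0 mulr0.
- have -> : (c *: x + y : freeZ)
           = (c%:A : weyl K) *: (x : laurent) + y :> laurent.
    by rewrite alg_scale.
  have h : wD K * c%:A = c%:A * wD K by rewrite alg_comm -scalerAl mul1r.
  rewrite scalerDr scalerA h -scalerA alg_scale.
  by rewrite alg_scale !coeffD !coeffZ IHx IHy mulrDr mulrCA.
- apply: (etrans (congr1 (coeff m) (laurent_wD n))).
  rewrite alg_scale coeffZ coeffU mul1r.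
  by case: eqP => [->//|_]; rewrite !mulr0.
Qed.

(** The monomials are eigenvectors of [D] with distinct eigenvalues: applying
    [D - n] for the exponents [n] of a nonzero element of a submodule, one at a
    time, isolates a monomial, which generates everything. *)
Lemma laurent_irreducible : irreducible_module laurent.
Proof.
split; first by exists (mono 0); apply/eqP; rewrite freegU_eq0 oner_eq0.
move=> W [W0 WD].
have [h|/existsNP[x /not_implyP[Wx /eqP xn0]]] :=
  pselect (forall v, W v -> v = 0); first by left.
right.
have WZ a v : W v -> W (a *: v).
  by move=> Wv; have := WD a v 0 Wv W0; rewrite addr0.
suff [n Wn] : exists n, W (mono n).
  apply: freeg_span => [//|c u v Wu Wv|m].
  - have := WD c%:A u v Wu Wv; congr W.
    by rewrite alg_scale.
  - by have := WZ (wtpow K (m - n)) _ Wn; rewrite laurent_wtpow subrK.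
(* Induction on a list containing the support of [x]. *)
have: forall m, coeff m (x : freeZ) != 0 -> m \in dom (x : freeZ).
  by move=> m; rewrite mem_dom.
move: (dom (x : freeZ)) => s; elim: s x Wx xn0 => [|n s IH] x Wx xn0 xs.
  case/eqP: xn0; apply/eqP/freeg_eqP => m; rewrite coeff0.
  by apply/eqP/negP => /negP/xs.
pose y : laurent := (wD K - (n%:~R : K)%:A) *: x.
have yE m : coeff m (y : freeZ) = (m - n)%:~R * coeff m (x : freeZ).
  rewrite /y scalerBl coeffB coeff_wD alg_scale coeffZ -mulrBl.
  by rewrite rmorphB.
have [y0|yn0] := eqVneq (y : freeZ) 0; last first.
  apply: (IH y); [exact: WZ|by []|] => m; rewrite yE mulf_eq0 negb_or.
  rewrite intr_eq0 subr_eq0 => /andP[mn /xs]; rewrite inE.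
  by rewrite (negPf mn).
(* If [D - n] kills [x], then [x] is a multiple of the monomial [t^n]. *)
have xE : (x : freeZ) = coeff n (x : freeZ) *: << n >>.
  apply/eqP/freeg_eqP => m; rewrite coeffZ coeffU mul1r.
  have := yE m; rewrite y0 coeff0 => /esym/eqP.
  rewrite mulf_eq0 intr_eq0 subr_eq0 [n == m]eq_sym.
  by case: eqVneq => [->|_] /=; rewrite ?mulr1 // mulr0 => /eqP.
exists n; have cn0 : coeff n (x : freeZ) != 0.
  by apply/eqP => c0; move/eqP: xn0; apply; rewrite xE c0 scale0r.
have := WZ (coeff n (x : freeZ))^-1%:A x Wx; rewrite alg_scale {2}xE.
by rewrite scalerA mulVf // scale1r.
Qed.

End Laurent.

(** * The functor *)

Section Functor.
Variables (K : numFieldType) (e : bool).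

Local Notation g := (svir K e).

(** A linear subspace contains the orbit of [v] under the Lie superalgebra as
    soon as it contains the images of [v] under the [L_m] and the [G_p]. *)
Lemma svir_act_ind (b : K) (M : lmodType (weyl K)) (W : tot (dbl M) -> Prop) v :
    W 0 -> (forall c u w, W u -> W w -> W (c *: u + w)) ->
    (forall m, W (svir_actL e b m v)) -> (forall k, W (svir_actG e b k v)) ->
  forall x : tot g, W (svir_act b x v).
Proof.
move=> W0 WD WL WG [x1 x2].
rewrite /svir_act -[fglift _ _]scale1r /=; apply: (WD).
- elim/freeg_span: x1 => [|c x y Wx Wy|m]; first by rewrite fglift0.
  + by rewrite fglift_linear; apply: (WD).
  + by rewrite liftU scale1r.
- elim/freeg_span: x2 => [|c x y Wx Wy|m]; first by rewrite fglift0.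
  + by rewrite fglift_linear; apply: (WD).
  + by rewrite liftU scale1r.
Qed.

Section Morphism.
Variables (b : K) (M N : lmodType (weyl K)) (f : {linear M -> N}).

Lemma dbl_map_linear : linear (dbl_map f).
Proof. by move=> c u v; apply: tot_eq; apply: linearP. Qed.

Lemma dbl_map_uact x (v : underlying M) : f (uact x v) = uact x (f v).
Proof. exact: linearZ. Qed.

Lemma dbl_map_act (x : tot g) v :
  dbl_map f (svir_act b x v) = svir_act b x (dbl_map f v).
Proof.
have f0 : dbl_map f 0 = 0 :> tot (dbl N).
  by apply: (@tot_eq _ (dbl N)); apply: linear0.
have fN (u : underlying M) : f (- u) = - f u by apply: linearN.
case: x => x1 x2; rewrite /svir_act -[X in dbl_map f (X + _)]scale1r.
rewrite dbl_map_linear scale1r /=; congr (_ + _).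
- elim/freeg_span: x1 => [|c x y IHx IHy|m]; first by rewrite !fglift0.
  + by rewrite !fglift_linear dbl_map_linear IHx IHy.
  + rewrite !liftU !scale1r !svir_actLE.
    by apply: (@tot_eq _ (dbl N)); rewrite /= fN dbl_map_uact.
- elim/freeg_span: x2 => [|c x y IHx IHy|m]; first by rewrite !fglift0.
  + by rewrite !fglift_linear dbl_map_linear IHx IHy.
  + rewrite !liftU !scale1r !svir_actGE.
    by apply: (@tot_eq _ (dbl N)); rewrite /= ?fN dbl_map_uact.
Qed.

Lemma dbl_map_morphism :
  @is_lie_morphism K g (LieModule (svir_act_is_module e b M))
    (LieModule (svir_act_is_module e b N)) (dbl_map f).
Proof.
split; [exact: dbl_map_linear | | exact: dbl_map_act].
by case=> v hv; apply: (etrans (congr1 f hv)); apply: linear0.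
Qed.

End Morphism.

Lemma svir_functorP b :
  @is_functor (Mod (weyl K)) (LieMod g)
    (fun M => LieModule (svir_act_is_module e b M))
    (fun M N f => LieMorphism (dbl_map_morphism b f)).
Proof.
by split=> *; apply: lieMorphism_ext => -[].
Qed.

(** The functor sending [M] to its double and a morphism [f] to [dbl_map f]. *)
Definition svir_functor b : functor (Mod (weyl K)) (LieMod g) :=
  Functor (svir_functorP b).

(** * Irreducibility *)

Section Submodule.
Variables (b : K) (M : lmodType (weyl K)).
Local Notation H := (LieModule (svir_act_is_module e b M)).

(** A pair of subspaces of the even and odd parts that are stable under the
    components of the [L_m] and of the [G_p] is a graded submodule. *)
Lemma dbl_submodule (W0 W1 : underlying M -> Prop) :
    W0 0 -> W1 0 ->
    (forall c u v, W0 u -> W0 v -> W0 (c *: u + v)) ->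
    (forall c u v, W1 u -> W1 v -> W1 (c *: u + v)) ->
    (forall m v, W0 v -> W0 (- uact (wtD m (weight_even e b m)) v)) ->
    (forall m v, W1 v -> W1 (- uact (wtD m (weight_odd e b m)) v)) ->
    (forall k v, W0 v -> W1 (uact (wtD k (2 * k%:~R * b)) v)) ->
    (forall n v, W1 v -> W0 (- uact (wtpow K n) v)) ->
  @lie_submodule K g H (fun v => W0 v.1 /\ W1 v.2).
Proof.
move=> W00 W10 W0D W1D WL0 WL1 WG0 WG1; split => //=.
- by move=> c v w [? ?] [? ?]; split; [apply: W0D | apply: W1D].
- by move=> v [? ?].
- move=> x v [v0 v1].
  apply: (svir_act_ind (W := fun u => W0 u.1 /\ W1 u.2)) => //.
  + by move=> c u w [? ?] [? ?]; split; [apply: W0D | apply: W1D].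
  + by move=> m; rewrite svir_actLE; split; [apply: WL0 | apply: WL1].
  + by move=> k; rewrite svir_actGE; split; [apply: WG1 | apply: WG0].
Qed.

(** Irreducibility for [b] different from 0 and 1/2, by showing that the even and
    odd parts of a graded submodule are submodules over the Weyl algebra. *)
Lemma irreducible_dbl : b <> 0 -> b <> 1 / 2 ->
  irreducible_module M -> irreducible_lie_module H.
Proof.
move=> b0 b12 [[v0 v0n0] irr].
split; first by exists (v0, 0) => -[].
move=> W [W0 WD Wgr Wact].
pose We (v : M) := W (v, 0); pose Wo (v : M) := W (0, v).
have WN u : W u -> W (- u).
  by move=> Wu; have := WD (-1) u 0 Wu W0; rewrite addr0 scaleN1r.
have WA u w : W u -> W w -> W (u + w).
  by move=> Wu Ww; have := WD 1 u w Wu Ww; rewrite scale1r.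
have WZ c u : W u -> W (c *: u).
  by move=> Wu; have := WD c u 0 Wu W0; rewrite addr0.
have WG0 k v : We v -> Wo (wtD k (2 * k%:~R * b) *: v).
  move=> /(Wact (svG K k)); rewrite [mod_act _ _]svir_act_svG svir_actGE.
  by rewrite /= uact0 oppr0.
have WG1 n v : Wo v -> We (wtpow K n *: v).
  move=> /(Wact (svG K (n - e%:Z))); rewrite [mod_act _ _]svir_act_svG.
  rewrite svir_actGE subrK => /WN; rewrite /= uact0; congr W; apply: tot_eq => /=.
  - by rewrite opprK.
  - by rewrite oppr0.
have WeA u v : We u -> We v -> We (u + v).
  move=> Wu Wv; have := WA _ _ Wu Wv.
  by congr W; apply: tot_eq; rewrite //= addr0.
have WoA u v : Wo u -> Wo v -> Wo (u + v).
  move=> Wu Wv; have := WA _ _ Wu Wv.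
  by congr W; apply: tot_eq; rewrite //= addr0.
have WeZ c v : We v -> We (c%:A *: v).
  move=> Wv; have := WZ c _ Wv.
  by congr W; apply: tot_eq; rewrite //= scaler0.
have WoZ c v : Wo v -> Wo (c%:A *: v).
  move=> Wv; have := WZ c _ Wv.
  by congr W; apply: tot_eq; rewrite //= scaler0.
have We1 n k v : We v -> We (wtD (n + k) (2 * k%:~R * b) *: v).
  by move=> /(WG0 k)/(WG1 n); rewrite scalerA wtpow_wtD.
have Wo1 n k v : Wo v -> Wo (wtD (n + k) (n%:~R + 2 * k%:~R * b) *: v).
  move=> /(WG1 n)/(WG0 k); rewrite scalerA wtD_wtpow.
  by rewrite [k + n]addrC [_ + n%:~R]addrC.
(* Two operators [t^n (D + c)] with distinct constants yield [t^n]. *)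
have pow (P : M -> Prop) n c d v : (forall u w, P u -> P w -> P (u + w)) ->
    (forall c u, P u -> P (c%:A *: u)) -> c != d ->
    P (wtD n c *: v) -> P (wtD n d *: v) -> P (wtpow K n *: v).
  move=> PD PZ cd Pc Pd; rewrite -subr_eq0 in cd.
  have := PZ (c - d)^-1 _ (PD _ _ Pc (PZ (-1) _ Pd)).
  rewrite scalerA -scalerDl scalerA scaleN1r mulNr mul1r wtDB.
  by rewrite -scalerAl mul1r scalerA mulVf ?scale1r.
have wtD00 : wtD 0 0 = wD K by rewrite /wtD mul1r scale0r addr0.
have We_sub : is_submodule We.
  apply: weyl_submodule => // [n|] v Wv.
  - apply: (pow _ n 0 (2 * b)) => //.
    + by rewrite eq_sym mulf_neq0 ?pnatr_eq0 //; apply/eqP.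
    + by have := We1 n 0 _ Wv; rewrite addr0 mulr0 mul0r.
    + by have := We1 (n - 1) 1 _ Wv; rewrite subrK mulr1.
  - by have := We1 0 0 _ Wv; rewrite addr0 mulr0 mul0r wtD00.
have Wo_sub : is_submodule Wo.
  apply: weyl_submodule => // [n|] v Wv.
  - apply: (pow _ n n%:~R (n%:~R - 1 + 2 * b)) => //.
    + rewrite -addrA -[X in X != _]addr0 (inj_eq (addrI _)) eq_sym addrC.
      rewrite subr_eq0; apply/eqP => h; apply: b12.
      by apply: (canRL (mulfK _)); rewrite ?pnatr_eq0 // mulrC.
    + by have := Wo1 n 0 _ Wv; rewrite addr0 mulr0 mul0r addr0.
    + by have := Wo1 (n - 1) 1 _ Wv; rewrite subrK mulr1 rmorphB.
  - by have := Wo1 0 0 _ Wv; rewrite addr0 mulr0 mul0r addr0 wtD00.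
case: (irr We We_sub) => [We0|WeT].
  left=> v /Wgr[v1 v2]; apply: tot_eq => /=; first exact: We0.
  by have := WG1 0 _ v2; rewrite scale1r => /We0.
case: (irr Wo Wo_sub) => [Wo0|WoT].
  (* A zero odd part would make [D] and [t (D + 2 b)] vanish on [M]. *)
  have Dv0 := Wo0 _ (WG0 0 _ (WeT v0)).
  have tDv0 := Wo0 _ (WG0 1 _ (WeT v0)).
  have tv0 : wtpow K 1 *: v0 = 0.
    apply: (pow (fun v => v = 0) 1 (2 * b) 0).
    - by move=> u w -> ->; rewrite addr0.
    - by move=> c u ->; rewrite scaler0.
    - by rewrite mulf_neq0 ?pnatr_eq0 //; apply/eqP.
    - by rewrite mulr1 in tDv0.
    - rewrite mulr0 mul0r in Dv0.
      by rewrite -[1]addr0 -wtpow_wtD -scalerA Dv0 scaler0.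
  by case: v0n0; rewrite -[v0]scale1r -(wtpowNK K 1) -scalerA tv0 scaler0.
right=> v; have := WA _ _ (WeT v.1) (WoT v.2).
by congr W; apply: tot_eq; rewrite /= ?addr0 ?add0r.
Qed.

(** At [b = 0] the kernel of [D] in the even part is a submodule, nonzero because
    it contains [v] and proper because it has no odd part. *)
Lemma reducible_at_0 (v : M) : b = 0 -> v <> 0 -> wD K *: v = 0 ->
  ~ irreducible_lie_module H.
Proof.
move=> b0 vn0 Dv0 [_ irr].
have k0 n c (u : underlying M) : c = 0 -> uact (wD K) u = 0 ->
    uact (wtD n c) u = 0.
  by move=> -> Du; rewrite /wtD scale0r addr0 uactM Du uact0.
case: (irr (fun u => uact (wD K) u.1 = 0 /\ u.2 = 0)).
- apply: (@dbl_submodule (fun u => uact (wD K) u = 0) (fun u => u = 0)) => //.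
  + exact: uact0.
  + by move=> c u w Du Dw; rewrite uactDr uactZr Du Dw scaler0 addr0.
  + by move=> c u w -> ->; rewrite scaler0 addr0.
  + by move=> m u Du; rewrite k0 ?oppr0 ?uact0 // /weight_even b0 mulr0.
  + by move=> m u ->; rewrite uact0 oppr0.
  + by move=> k u Du; rewrite k0 // b0 mulr0.
  + by move=> n u ->; rewrite uact0 oppr0 uact0.
- by move=> /(_ (v, 0)) h; apply: vn0; case: (h (conj Dv0 erefl)).
- by move=> /(_ (0, v))[_ /=].
Qed.

(** At [b = 1/2] the even part together with the image of [D] in the odd part is a
    submodule: the operators with values in the odd part are then
    [t^k (D + k) = D t^k]. It is proper because [v] is not in that image. *)
Lemma reducible_at_half (v : M) : b = 1 / 2 ->
  ~ (exists u, v = wD K *: u) -> ~ irreducible_lie_module H.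
Proof.
move=> b12 vnD [_ irr].
have Dt n (u : underlying M) :
    uact (wtD n n%:~R) u = uact (wD K) (uact (wtpow K n) u).
  by rewrite -uactM wD_wtpow.
have half2 : 2 * b = 1 by rewrite b12 mulrC mulfVK ?pnatr_eq0.
case: (irr (fun u => True /\ exists w, u.2 = uact (wD K) w)).
- apply: (@dbl_submodule (fun=> True) (fun u => exists w, u = uact (wD K) w))
    => //.
  + by exists 0; rewrite uact0.
  + move=> c u w [u' ->] [w' ->]; exists (c *: u' + w').
    by rewrite uactDr uactZr.
  + move=> m u [w ->]; exists (- uact (wtpow K m) (uact (wD K) w)).
    rewrite uactNr -Dt; congr (- uact (wtD _ _) _).
    by rewrite /weight_odd b12; field.
  + move=> k u _; exists (uact (wtpow K k) u); rewrite -Dt.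
    congr (uact (wtD _ _) _); by rewrite mulrAC half2 mul1r.
- move=> /(_ (v, 0)) h; apply: vnD; exists 0; rewrite scaler0.
  have D0 : exists w : underlying M, 0 = uact (wD K) w.
    by exists 0; rewrite uact0.
  by case: (h (conj I D0)).
- by move=> /(_ (0, v))[_ /=].
Qed.

End Submodule.

Lemma laurent_reducible b : b = 0 \/ b = 1 / 2 ->
  ~ irreducible_lie_module (svir_functor b (laurent K)).
Proof.
pose one : laurent K := << 0 >>.
case=> hb.
- apply: (reducible_at_0 (v := one) hb).
  + by apply/eqP; rewrite freegU_eq0 oner_eq0.
  + by rewrite laurent_wD !scale0r.
- apply: (reducible_at_half (v := one) hb) => -[u /(congr1 (coeff 0))].
  by rewrite coeff_wD mul0r coeffU eqxx mulr1 => /eqP; rewrite oner_eq0.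
Qed.

Lemma preserves_irreducibleP b :
  preserves_irreducible (svir_functor b) <-> b <> 0 /\ b <> 1 / 2.
Proof.
split=> [irr | [b0 b12] M].
- have h := irr _ (laurent_irreducible K).
  by split=> hb; apply: (laurent_reducible _ h); [left | right].
- exact: irreducible_dbl.
Qed.

(** * Isomorphisms between the functors *)

(** Already an isomorphism at a single nonzero module determines [b]. *)
Lemma iso_eq b1 b2 (M : lmodType (weyl K))
    (f : chom (svir_functor b1 M) (svir_functor b2 M)) :
  (exists v : M, v <> 0) -> is_iso f -> b1 = b2.
Proof.
case: f => f [/= fD fh fact] [v vn0] [h /= [hf _]].
have f0 : f 0 = 0.
  by have := fD (-1) 0 0; rewrite scaler0 addr0 scaleN1r addNr.
have finj u : f u = 0 -> u = 0.
  have E w : h (f w) = w by exact: (congr1 (fun k => lmor_fun k w) hf).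
  by move=> fu; rewrite -(E u) -(E 0) f0 fu.
(* The restrictions of [f] to the even and odd parts. *)
pose F (u : underlying M) : underlying M := (f (u, 0)).1.
pose F' (u : underlying M) : underlying M := (f (0, u)).2.
have fe u : f (u, 0) = (F u, 0).
  by apply: tot_eq => //=; apply: (fh false).
have fo u : f (0, u) = (0, F' u).
  by apply: tot_eq => //=; apply: (fh true).
have FD c u w : F (c *: u + w) = c *: F u + F w.
  have -> : F (c *: u + w) = (f (c *: (u, 0) + (w, 0))).1.
    by congr ((f _).1); apply: tot_eq; rewrite //= scaler0 addr0.
  by rewrite fD !fe.
have F0 : F 0 = 0 by rewrite /F [f _]f0.
have FN u : F (- u) = - F u.
  by have := FD (-1) u 0; rewrite !addr0 F0 !scaleN1r addr0.
have Ft n u : F (uact (wtpow K n) u) = uact (wtpow K n) (F' u).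
  have := fact (svG K (n - e%:Z)) (0, u).
  rewrite !svir_act_svG !svir_actGE fo /= !subrK uact0 fe FN uact0.
  by move=> /(congr1 fst) /= /oppr_inj.
have F'E u : F' u = F u by have := Ft 0 u; rewrite !uact1.
have FG k u : F (uact (wtD k (2 * k%:~R * b1)) u)
              = uact (wtD k (2 * k%:~R * b2)) (F u).
  have := fact (svG K k) (u, 0).
  rewrite !svir_act_svG !svir_actGE fe /= !uact0 oppr0 fo F'E.
  by move=> /(congr1 snd).
(* [t (D + c)] splits as [t D + c t], so that [G_(1 + epsilon)] can be compared
   with [G_epsilon], which gives [D]. *)
have wtDE c : wtD 1 c = wtpow K 1 * wtD 0 0 + c *: wtpow K 1.
  by rewrite wtpow_wtD addr0 -[c in RHS]subr0 -wtDB addrC subrK.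
apply/eqP; rewrite -subr_eq0; apply/negPn/negP => b12n0; apply: vn0.
have tF0 : uact (wtpow K 1) (F v) = 0.
  have := FG 1 v; have := FG 0 v; rewrite mulr1 !mulr0 !mul0r !wtDE => FG0.
  rewrite !uactDl !uactZl !(uactM _ (wtD 0 0)) addrC FD !Ft !F'E FG0 addrC.
  move=> /addrI/eqP; rewrite -subr_eq0 -scalerBl -mulrBr scaler_eq0.
  by rewrite mulf_eq0 pnatr_eq0 /= (negPf b12n0) => /eqP.
have Fv0 : F v = 0 by rewrite -[F v]uact1 -(wtpowNK K 1) uactM tF0 uact0.
by have := finj (v, 0); rewrite fe Fv0 => /(_ erefl) [].
Qed.

Lemma nat_isomorphicP b1 b2 :
  nat_isomorphic (svir_functor b1) (svir_functor b2) <-> b1 = b2.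
Proof.
split=> [[eta [_ iso]] | <-].
- have [nz _] := laurent_irreducible K.
  exact: (iso_eq nz (iso (laurent K))).
- exists (fun M => idc _); split=> [M N f | M].
  + by rewrite ccomp_idl ccomp_idr.
  + by exists (idc _); rewrite ccomp_idl.
Qed.

End Functor.

(* [e] is 2 epsilon; [rho b M] is the action of g[epsilon] on H_{epsilon,b}(M),
   and the odd basis element G_p is [svG R[i] k] with k = p - epsilon. *)
Theorem mainTheorem1 (R : realType) (e : bool) :
  let g : lieSuperalgebra R[i] := svir R[i] e in
  let eps : R[i] := eps R[i] e in
  exists (rho : forall (b : R[i]) (M : lmodType (weyl R[i])),
            tot g -> tot (dbl M) -> tot (dbl M))
         (rhoP : forall b M, @is_module R[i] g (dbl M) (rho b M))
         (morP : forall b (M N : lmodType (weyl R[i])) (f : {linear M -> N}),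
            @is_lie_morphism R[i] g (LieModule (rhoP b M)) (LieModule (rhoP b N))
              (dbl_map f))
         (funP : forall b,
            @is_functor (Mod (weyl R[i])) (LieMod g)
              (fun M => LieModule (rhoP b M))
              (fun M N f => LieMorphism (morP b M N f))),
  let H (b : R[i]) : functor (Mod (weyl R[i])) (LieMod g) := Functor (funP b) in
  [/\ (forall b (M : lmodType (weyl R[i])) (m : int) (v : tot (dbl M)),
         rho b M (svL R[i] m) v =
         - dact (wtpow R[i] m)
             (dact (wD R[i]) v + ((m%:~R - 2 * eps) * b) *: v
              + ((m%:~R + 2 * eps) / 2) *: theta (dtheta v))),
      (forall b (M : lmodType (weyl R[i])) (k : int) (v : tot (dbl M)),
         let p : R[i] := k%:~R + eps in
         rho b M (svG R[i] k) v =
         dact (wtpow R[i] k)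
           (theta (dact (wD R[i]) v) + (2 * (p - eps) * b) *: theta v
            - dact (wtpow R[i] e%:Z) (dtheta v))),
      (forall b, preserves_irreducible (H b) <-> b <> 0 /\ b <> 1 / 2)
    & (forall b1 b2, nat_isomorphic (H b1) (H b2) <-> b1 = b2)].
Proof.
move=> g eps.
exists (fun b M => @svir_act R[i] e b M), (fun b M => svir_act_is_module e b M).
exists (fun b M N f => dbl_map_morphism e b f), (fun b => svir_functorP e b).
move=> H; split.
- by move=> b M m v; apply: svir_act_svL.
- by move=> b M k p v; apply: svir_act_svG.
- exact: preserves_irreducibleP.
- exact: nat_isomorphicP.
Qed.
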